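(* Let $p$ be a prime. For $i\geq 1$, we have $$f_{c_i,\mathbb{F}_p}(X)=f_{a_{i-1},\mathbb{F}_p}(X^p-X).$$ In particular, this polynomial is irreducible in $\mathbb{F}_p[X]$.
   Context: Fix a prime $p$ and an algebraic closure $E$ of $\mathbb{F}_p$. Put $c_{-1}=1$ and, recursively for $i\geq -1$, let $c_{i+1}\in E$ be any chosen root of $X^p-X-(c_{-1}c_0\cdots c_i)^{p-1}$. Put $a_i=(c_{-1}c_0\cdots c_i)^{p-1}$ for $i\geq -1$. For an element $\alpha$ algebraic over a field $F$, $f_{\alpha,F}(X)\in F[X]$ denotes the (monic) minimal polynomial of $\alpha$ over $F$. *)

(* Defs.v *)
From mathcomp Require Import all_boot all_order all_algebra.
From mathcomp Require Import boolp classical_sets.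

Set Implicit Arguments.
Unset Strict Implicit.
Unset Printing Implicit Defensive.

Import Order.TTheory GRing.Theory Num.Theory.
Local Open Scope ring_scope.

Section MinimalPolynomial.
Variables (F E : fieldType) (iota : {rmorphism F -> E}).

Definition is_minpoly (x : E) (f : {poly F}) : Prop :=
  [/\ f \is monic, root (map_poly iota f) x &
      forall g : {poly F}, g != 0 -> root (map_poly iota g) x ->
        (size f <= size g)%N].

(* The library's [minPoly] lives in finite-dimensional extensions only, so it
   does not apply to an algebraic closure.  The value 0 is returned when [x] is
   transcendental over [F]. *)
Definition minpoly (x : E) : {poly F} := xget 0 (is_minpoly x).

Lemma is_minpoly_ex x : algebraicOver iota x -> exists f, is_minpoly x f.
Proof.
case=> q q0 qx.
pose P n := `[< exists g : {poly F}, [/\ g != 0, root (map_poly iota g) x &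
                                         size g = n] >].
have exP : exists n, P n by exists (size q); apply/asboolP; exists q.
case: (ex_minnP exP) => n /asboolP[g [g0 gx sg]] nmin.
have lg0 : (lead_coef g)^-1 != 0 by rewrite invr_eq0 lead_coef_eq0.
exists ((lead_coef g)^-1 *: g); split.
- by rewrite monicE lead_coefZ mulVf // lead_coef_eq0.
- by rewrite map_polyZ rootZ ?fmorph_eq0.
- move=> h h0 hx; rewrite size_scale // sg.
  by apply: nmin; apply/asboolP; exists h.
Qed.

Lemma minpolyP x : algebraicOver iota x -> is_minpoly x (minpoly x).
Proof. by move=> /is_minpoly_ex; exact: xgetPex. Qed.

Lemma is_minpoly_uniq x f g : is_minpoly x f -> is_minpoly x g -> f = g.
Proof.
move=> [fm fx fmin] [gm gx gmin].
have f0 := monic_neq0 fm; have g0 := monic_neq0 gm.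
have sfg : size f = size g by apply/eqP; rewrite eqn_leq fmin ?gmin.
apply/eqP; rewrite -subr_eq0; apply/negP => /negP d0.
have dx : root (map_poly iota (f - g)) x.
  by rewrite rmorphB rootE hornerD hornerN (eqP fx) (eqP gx) subrr.
have := fmin _ d0 dx; apply/negP; rewrite -ltnNge.
have sf : (0 < size f)%N by rewrite size_poly_gt0.
rewrite -(prednK sf) ltnS; apply/leq_sizeP => j.
rewrite leq_eqVlt coefB => /predU1P[<-|lej].
  rewrite {2}sfg -/(lead_coef f) -/(lead_coef g).
  by rewrite (monicP fm) (monicP gm) subrr.
by rewrite (prednK sf) in lej; rewrite !nth_default ?subrr // -sfg.
Qed.

End MinimalPolynomial.

Section Tower.
Variables (p : nat) (E : fieldType).

(* The product runs over the indices -1, 0, ..., i when -1 <= i; values of [c]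
   at indices below -1 are irrelevant. *)
Definition tower_a (c : int -> E) (i : int) : E :=
  (\prod_(j < absz (i + 2)) c (j%:Z - 1)) ^+ p.-1.

Definition is_tower (c : int -> E) : Prop :=
  c (-1) = 1 /\
  forall i : int, -1 <= i -> root ('X^p - 'X - (tower_a c i)%:P) (c (i + 1)).

End Tower.

(* Main.v *)
(** Let N = p^i, and let sigma be the Frobenius x |-> x^p.  Telescoping gives
    sigma^N (c_i) = c_i + T_i with T_i = \sum_(k < N) sigma^k (a_{i-1}), and
    T_i = (-1)^i: indeed a_i = a_{i-1} c_i^(p-1), and summing this over the p
    translates c_i + j T_i of c_i multiplies a_{i-1} by
    \sum_j (c_i + j T_i)^(p-1) = -1.  So T_i is a nonzero element of F_p, and
    c_i, c_i + T_i have the same minimal polynomial g over F_p.  Hence g is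
    invariant under X |-> X + T_i, so that g = u(X^p - X) for some u, which
    vanishes at c_i^p - c_i = a_{i-1}; thus deg g >= p deg f_{a_{i-1}}. *)

Require Import Defs.
From mathcomp Require Import all_boot all_order all_algebra.

Import Order.TTheory GRing.Theory Num.Theory.
Local Open Scope ring_scope.

(** In any factorization of [f], one factor vanishes at [x]; minimality gives that factor full size,
    so the other is constant. *)
Lemma minpoly_irreducible (F E : fieldType) (iota : {rmorphism F -> E})
    (x : E) (f : {poly F}) : is_minpoly iota x f -> irreducible_poly f.
Proof.
move=> [fmon fx fmin]; have f0 := monic_neq0 fmon.
split=> [|q q1 qf].
  rewrite ltnNge; apply/negP => /size1_polyC fE; move: fx f0.
  by rewrite fE map_polyC rootC fmorph_eq0 polyC_eq0 => ->.
rewrite -dvdp_size_eqp // eqn_leq dvdp_leq //=.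
have /dvdpP[r fE] := qf; move: fx f0.
rewrite fE rmorphM rootM mulf_eq0 negb_or => /orP[rx|qx] /andP[r0 q0]; last first.
  by rewrite -fE fmin.
case/negP: q1; have := fmin _ r0 rx; rewrite fE size_mul //.
move: r0 q0; rewrite -!size_poly_gt0.
case: (size r) (size q) => [//|m] [//|[//|n]] _ _ /=.
by rewrite !addnS ltnS ltnNge leq_addr.
Qed.

(** * Frobenius powers and translation-invariant polynomials in characteristic p *)

Section CharP.
Variables (K : fieldType) (p : nat).
Hypothesis pcharK : p \in [pchar K].

Let p_pr : prime p := pcharf_prime pcharK.

Lemma pchar_pnat k : [pchar K].-nat (p ^ k)%N.
Proof. by rewrite pnatX pnatE // pcharK. Qed.

Lemma frobD k : {morph (fun x : K => x ^+ (p ^ k)) : x y / x + y}.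
Proof. by move=> x y; rewrite exprDn_pchar // pchar_pnat. Qed.

Lemma frob_sum I (r : seq I) (P : pred I) (F : I -> K) k :
  (\sum_(i <- r | P i) F i) ^+ (p ^ k) = \sum_(i <- r | P i) F i ^+ (p ^ k).
Proof.
apply: (big_morph (fun x : K => x ^+ (p ^ k))); first exact: frobD.
by rewrite expr0n expn_eq0 -leqn0 leqNgt prime_gt0.
Qed.

(** Frobenius is additive, so the k-th summand is c^(p^(k+1)) - c^(p^k) and the sum telescopes. *)
Lemma frob_iter_trace (c : K) n :
  c ^+ (p ^ n) = c + \sum_(k < n) (c ^+ p - c) ^+ (p ^ k).
Proof.
elim: n => [|n IHn]; first by rewrite big_ord0 addr0 expr1.
rewrite big_ord_recr addrA -IHn /= exprDn_pchar ?pchar_pnat //.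
by rewrite exprNn_pchar ?pchar_pnat // -exprM -expnS addrC subrK.
Qed.

Variable t : K.
Hypotheses (t_neq0 : t != 0) (tp : t ^+ p = t).

Lemma multiples_uniq : uniq [seq t *+ j | j <- iota 0 p].
Proof.
rewrite map_inj_in_uniq ?iota_uniq // => i j; rewrite !mem_iota !add0n /=.
wlog lij : i j / (i <= j)%N => [hwlog lip ljp e|_ ljp /eqP].
  by case/orP: (leq_total i j) => /hwlog->.
rewrite eq_sym -subr_eq0 -mulrnBr // -mulr_natr mulf_eq0 (negPf t_neq0) /=.
rewrite -(dvdn_pcharf pcharK) => pji; apply/eqP; rewrite eqn_leq lij /=.
rewrite -subn_eq0 -leqn0 leqNgt; apply/negP => /dvdn_leq/(_ pji).
by rewrite leqNgt (leq_ltn_trans (leq_subr _ _) ljp).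
Qed.

Lemma size_XpX : size ('X^p - 'X : {poly K}) = p.+1.
Proof.
by rewrite size_polyDl size_polyXn // size_polyN size_polyX ltnS prime_gt1.
Qed.

Lemma XpX_neq0 : 'X^p - 'X != 0 :> {poly K}.
Proof. by rewrite -size_poly_eq0 size_XpX. Qed.

Lemma horner_shift_invariant {q : {poly K}} (x : K) (j : nat) :
  q \Po ('X + t%:P) = q -> q.[x + t *+ j] = q.[x].
Proof.
move=> qt; elim: j => [|j IHj]; first by rewrite addr0.
by rewrite mulrSr addrA -IHj -{2}qt horner_comp !hornerE.
Qed.

(* [0, t, ..., (p - 1) t] are p common roots of [q - q.[0]] and ['X^p - 'X]. *)
Lemma XpX_dvd_shift_invariant (q : {poly K}) :
  q \Po ('X + t%:P) = q -> 'X^p - 'X %| q - q.[0]%:P.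
Proof.
move=> qt; apply/modp_eq0P; set r := _ %% _.
apply: (roots_geq_poly_eq0 _ multiples_uniq).
  apply/allP => _ /mapP[j _ ->].
  have -> : r = q - q.[0]%:P - (q - q.[0]%:P) %/ ('X^p - 'X) * ('X^p - 'X).
    by apply/eqP; rewrite eq_sym subr_eq [X in _ == X]addrC /r -divp_eq.
  rewrite rootE !hornerE -[X in q.[X] - _]add0r.
  rewrite (horner_shift_invariant _ _ qt) subrr sub0r.
  have -> : (t *+ j) ^+ p = t *+ j.
    rewrite -[LHS]/(pFrobenius_aut pcharK _) pFrobenius_autMn.
    by rewrite pFrobenius_autE tp.
  by rewrite subrr mulr0 oppr0.
by rewrite size_map size_iota -ltnS -size_XpX ltn_modp XpX_neq0.
Qed.

(** Induction on the size: q - q(0) = r (X^p - X), and X^p - X is itself invariant because t^p = t.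
    Cancelling it shows that the smaller polynomial r is invariant too. *)
Lemma shift_invariant_comp (q : {poly K}) :
  q \Po ('X + t%:P) = q -> exists u : {poly K}, q = u \Po ('X^p - 'X).
Proof.
have [n] := ubnP (size q); elim: n q => [//|n IHn] q sq qt.
have [q1|q1] := leqP (size q) 1.
  by exists q; rewrite (size1_polyC q1) comp_polyC.
have /dvdpP[r qE] := XpX_dvd_shift_invariant _ qt.
have {}qE : q = r * ('X^p - 'X) + q.[0]%:P by rewrite -qE subrK.
have r0 : r != 0.
  apply: contraL q1 => /eqP r0.
  by rewrite qE r0 mul0r add0r -leqNgt size_polyC leq_b1.
have srq : (size r < n)%N.
  rewrite -ltnS; apply: leq_trans sq; rewrite ltnS.
  have : size (q - q.[0]%:P) = (size r + p)%N.
    by rewrite {1}qE addrK size_mul // ?XpX_neq0 // size_XpX addnS.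
  rewrite size_polyDl.
    by move=> ->; rewrite -addn1 leq_add2l prime_gt0.
  by rewrite size_polyN size_polyC (leq_ltn_trans (leq_b1 _)).
have [u rE] : exists u : {poly K}, r = u \Po ('X^p - 'X).
  apply: IHn => //; apply: (mulIf XpX_neq0); apply: (addIr q.[0]%:P).
  rewrite -[RHS]qE -[RHS]qt [in RHS]qE comp_polyD comp_polyM comp_polyC.
  congr (_ * _ + _); rewrite comp_polyB comp_Xn_poly comp_polyX.
  have pcharP : p \in [pchar {poly K}] by rewrite pchar_lalg.
  rewrite exprDn_pchar ?pnatE // -polyC_exp tp.
  by rewrite opprD addrACA subrr addr0.
exists (u * 'X + q.[0]%:P).
by rewrite comp_polyD comp_polyM comp_polyX comp_polyC -rE.
Qed.

(* The polynomial [\sum_j ('X + j t)^(p-1)] is invariant under translation by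
   [t] and has degree less than [p], so it is the constant [p - 1]. *)
Lemma sum_shifts_exp (c : K) : \sum_(j < p) (c + t *+ j) ^+ p.-1 = -1.
Proof.
have pS : p = p.-1.+1 by rewrite prednK ?prime_gt0.
pose P : {poly K} := \sum_(j < p) ('X + (t *+ j)%:P) ^+ p.-1.
have Pt : P \Po ('X + t%:P) = P.
  rewrite /P rmorph_sum /=.
  transitivity (\sum_(j < p) ('X + (t *+ j.+1)%:P : {poly K}) ^+ p.-1).
    apply: eq_bigr => j _; rewrite rmorphXn /= comp_polyD comp_polyX comp_polyC.
    by rewrite -addrA -polyCD mulrS.
  (* The shifted indices wrap around: p t = 0, so the last term is the old term at j = 0. *)
  rewrite pS big_ord_recr big_ord_recl /= -pS mulrn_pchar // addrC mulr0n.
  by congr (_ + _).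
have sP : (size P <= p)%N.
  apply: leq_trans (size_sum _ _ _) _; apply/bigmax_leqP => j _.
  by rewrite (leq_trans (size_poly_exp_leq _ _)) // size_XaddC mul1n -pS.
have PE : P = P.[0]%:P.
  apply/eqP; rewrite -subr_eq0; apply: contraT => /dvdp_leq.
  move=> /(_ _ (XpX_dvd_shift_invariant _ Pt)).
  rewrite size_XpX ltnNge (leq_trans (size_polyD _ _)) // geq_max sP.
  by rewrite size_polyN size_polyC (leq_trans (leq_b1 _)) // prime_gt0.
have P_horner x : P.[x] = \sum_(j < p) (x + t *+ j) ^+ p.-1.
  by rewrite horner_sum; apply: eq_bigr => j _; rewrite !hornerE.
(* At 0 the term j = 0 vanishes, as p - 1 > 0; each other term is 1, since j t is nonzero and (j
   t)^p = j t. *)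
rewrite -P_horner PE hornerC P_horner pS big_ord_recl /= mulr0n addr0.
have -> : 0 ^+ p.-1 = 0 :> K.
  by rewrite expr0n -leqn0 -ltnS -pS leqNgt prime_gt1.
rewrite add0r (eq_bigr (fun=> 1)) => [|j _].
  rewrite sumr_const card_ord; apply/eqP.
  by rewrite -subr_eq0 opprK -mulrSr -pS pcharf0.
rewrite add0r /bump leq0n add1n; have s0 : t *+ j.+1 != 0.
  rewrite -mulr_natr mulf_neq0 // -(dvdn_pcharf pcharK) gtnNdvd //.
  by rewrite [X in (_ < X)%N]pS ltnS ltn_ord.
apply: (mulfI s0); rewrite mulr1 -exprS -pS.
rewrite -[LHS]/(pFrobenius_aut pcharK _) pFrobenius_autMn.
by rewrite pFrobenius_autE tp.
Qed.

(** Write each exponent as j N + k with j < p and k < N. The (j N)-th Frobenius power fixes a and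
    sends c to c + j t, so summing over j first reduces to [sum_shifts_exp]. *)
Lemma trace_mul_exp (a c : K) (N : nat) :
    a ^+ (p ^ N) = a -> c ^+ (p ^ N) = c + t ->
  \sum_(k < p * N) (a * c ^+ p.-1) ^+ (p ^ k) = - \sum_(k < N) a ^+ (p ^ k).
Proof.
move=> aN cN.
have tk k : t ^+ (p ^ k) = t.
  by elim: k => [|k IHk]; rewrite ?expr1 // expnS exprM tp.
have aNj j : a ^+ (p ^ (j * N)) = a.
  by elim: j => [|j IHj]; rewrite ?expr1 // mulSn expnD exprM aN.
have cNj j : c ^+ (p ^ (j * N)) = c + t *+ j.
  elim: j => [|j IHj]; first by rewrite expr1 addr0.
  by rewrite mulSn expnD exprM cN frobD IHj tk mulrSr addrA.
rewrite -(big_mkord xpredT (fun k => (a * c ^+ p.-1) ^+ (p ^ k))) big_nat_mul.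
transitivity (\sum_(0 <= j < p) \sum_(0 <= k < N)
    (a * (c + t *+ j) ^+ p.-1) ^+ (p ^ k)).
  apply: eq_bigr => j _; rewrite -{1}[(j * N)%N]add0n big_addn.
  rewrite mulSn addnK; apply: eq_bigr => k _.
  by rewrite addnC expnD exprM exprMn aNj -exprM mulnC exprM cNj.
rewrite exchange_big /= big_mkord -sumrN; apply: eq_bigr => k _.
rewrite -frob_sum -mulr_sumr big_mkord sum_shifts_exp mulrN1.
by rewrite exprNn_pchar ?pchar_pnat.
Qed.

End CharP.

(** Frobenius fixes the coefficients, which lie in F_p, whence q(x^p) = q(x)^p. *)
Lemma root_frob (p : nat) (p_prime : prime p) (E : fieldType)
    (iota : {rmorphism 'F_p -> E}) (q : {poly 'F_p}) (x : E) k :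
  root (map_poly iota q) x -> root (map_poly iota q) (x ^+ (p ^ k)).
Proof.
have pcharF := pchar_Fp p_prime.
have pcharE : p \in [pchar E] := rmorph_pchar iota pcharF.
elim: k x => [|k IHk] x qx; first by rewrite expr1.
rewrite expnS exprM; apply: IHk; rewrite rootE.
have -> : (map_poly iota q).[x ^+ p] = (map_poly iota q).[x] ^+ p.
  rewrite !horner_coef -[RHS]/(pFrobenius_aut pcharE _) rmorph_sum /=.
  apply: eq_bigr => j _; rewrite pFrobenius_autE exprMn coef_map /=.
  rewrite -[in RHS]rmorphXn exprAC; congr (iota _ * _).
  rewrite -[RHS]/(pFrobenius_aut pcharF _) -[in RHS](natr_Zp q`_j).
  by rewrite pFrobenius_aut_nat natr_Zp.
by rewrite (eqP qx) expr0n -leqn0 leqNgt prime_gt0.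
Qed.

(** * The traces T_i along the tower *)

Section Tower.
Variables (p : nat) (E : fieldType) (c : int -> E).
Hypotheses (pcharE : p \in [pchar E]) (c_tower : is_tower p c).

Lemma tower_root (n : nat) : c n ^+ p - c n = tower_a p c (n%:Z - 1).
Proof.
have [_ /(_ (n%:Z - 1))] := c_tower; rewrite subrK.
have -> : -1 <= n%:Z - 1 by rewrite lerBDr.
by move=> /(_ isT) /eqP; rewrite !hornerE => /eqP; rewrite subr_eq0 => /eqP.
Qed.

Lemma tower_a_recl (n : nat) :
  tower_a p c n = tower_a p c (n%:Z - 1) * c n ^+ p.-1.
Proof.
have e1 : absz (n%:Z + 2) = n.+2 by rewrite -PoszD addn2.
have e2 : absz (n%:Z - 1 + 2) = n.+1.
  by rewrite -addrA (_ : -1 + 2 = 1%:Z) // -PoszD addn1.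
rewrite /tower_a e1 e2 big_ord_recr exprMn /=.
by rewrite -addn1 PoszD addrK.
Qed.

Lemma tower_trace (n : nat) :
  \sum_(k < p ^ n) tower_a p c (n%:Z - 1) ^+ (p ^ k) = (-1) ^+ n.
Proof.
have frobsign m k : ((-1) ^+ m : E) ^+ (p ^ k) = (-1) ^+ m.
  by rewrite -exprM mulnC exprM exprNn_pchar ?pchar_pnat // expr1n.
elim: n => [|n IHn].
  (* For n = 0 both the sum and the product have one term, coming from c_{-1} = 1. *)
  rewrite big_ord1 expr1 /tower_a big_ord1 /=.
  by have [-> _] := c_tower; rewrite expr1n.
rewrite -addn1 PoszD addrK addn1 tower_a_recl expnS.
have cN := frob_iter_trace _ _ pcharE (c n) (p ^ n).
rewrite tower_root IHn in cN.
rewrite (trace_mul_exp _ _ pcharE _ _ _ _ _ _ _ cN).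
- by rewrite IHn exprS mulN1r.
- by rewrite signr_eq0.
- by rewrite -[p in LHS]expn1 frobsign.
(* It remains to see that the p^n-th Frobenius power fixes a_{n-1} = c_n^p - c_n: it translates c_n
   by (-1)^n, which Frobenius fixes, so the two translations cancel. *)
rewrite -tower_root exprDn_pchar ?pchar_pnat // exprNn_pchar ?pchar_pnat //.
rewrite exprAC cN exprDn_pchar ?pcharE //.
  by rewrite -[p in _ ^+ n ^+ p]expn1 frobsign opprD addrACA subrr addr0.
by rewrite -[p]expn1 pchar_pnat.
Qed.

End Tower.

Theorem theorem6p4 (p : nat) (p_prime : prime p)
    (E : closedFieldType) (iota : {rmorphism 'F_p -> E})
    (E_alg : forall x : E, algebraicOver iota x)
    (c : int -> E) (c_tower : is_tower p c) (i : int) (i_ge1 : 1 <= i) :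
  minpoly iota (c i) = minpoly iota (tower_a p c (i - 1)) \Po ('X^p - 'X) /\
  irreducible_poly (minpoly iota (tower_a p c (i - 1)) \Po ('X^p - 'X)).
Proof.
case: i i_ge1 => // n _.
have pcharF := pchar_Fp p_prime.
have pcharE : p \in [pchar E] := rmorph_pchar iota pcharF.
set a := tower_a p c (n%:Z - 1); set f := minpoly iota a.
have ca : c n ^+ p - c n = a := tower_root _ _ _ c_tower n.
have [fmon fa fmin] := minpolyP (E_alg a); rewrite -/f in fmon fa fmin.
have [gmon gc gmin] := minpolyP (E_alg (c n)).
set g := minpoly iota (c n) in gmon gc gmin *.
pose t : 'F_p := (-1) ^+ n.
have t0 : t != 0 by rewrite signr_eq0.
have tp : t ^+ p = t.
  rewrite -[LHS]/(pFrobenius_aut pcharF _).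
  by rewrite rmorphXn /= pFrobenius_autN pFrobenius_aut1.
have hiota : map_poly iota ('X^p - 'X) = 'X^p - 'X.
  by rewrite rmorphB /= map_polyXn map_polyX.
(* The translate is monic of the same size as g, and it vanishes at c_n because c_n + t is a
   Frobenius conjugate of c_n; uniqueness of the minimal polynomial concludes. *)
have gt : g \Po ('X + t%:P) = g.
  have s2 : size ('X + t%:P) = 2%N by rewrite size_XaddC.
  apply: (@is_minpoly_uniq _ _ iota (c n)) => //; split=> //.
  - by rewrite monicE lead_coef_comp ?s2 // lead_coefXaddC expr1n mulr1 -monicE.
  - rewrite map_comp_poly root_comp rmorphD /= map_polyX map_polyC /= !hornerE.
    have -> : c n + iota t = c n ^+ (p ^ (p ^ n)).
      rewrite (frob_iter_trace _ _ pcharE) ca tower_trace //.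
      by rewrite rmorphXn rmorphN1.
    exact: root_frob.
  - by move=> q q0 qx; rewrite size_comp_poly2 // gmin.
have [u gE] := shift_invariant_comp _ _ pcharF _ t0 tp _ gt.
have u0 : u != 0.
  apply: contraTneq gmon => u0.
  by rewrite gE u0 comp_poly0 monicE lead_coef0 eq_sym oner_eq0.
have sh (v : {poly 'F_p}) : (size (v \Po ('X^p - 'X))).-1 = ((size v).-1 * p)%N.
  by rewrite size_comp_poly size_XpX.
have XpX_monic : lead_coef ('X^p - 'X : {poly 'F_p}) = 1.
  rewrite lead_coefDl ?lead_coefXn // size_polyXn size_polyN size_polyX.
  by rewrite ltnS prime_gt1.
have hmin : is_minpoly iota (c n) (f \Po ('X^p - 'X)).
  split.
  - rewrite monicE lead_coef_comp ?size_XpX // ?ltnS ?prime_gt0 //.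
    by rewrite XpX_monic expr1n mulr1 -monicE.
  - by rewrite map_comp_poly root_comp hiota !hornerE ca.
  (* It suffices to compare with g = u(X^p - X): by [sh] both degrees are p times those of f and u,
     and u vanishes at a. *)
  - move=> q q0 qx; apply: leq_trans (gmin q q0 qx).
    rewrite (leq_trans (leqSpred _)) // sh.
    have: (size f <= size u)%N.
      apply: fmin => //; move: gc.
      by rewrite gE map_comp_poly root_comp hiota !hornerE ca.
    move=> sfu; have g0 := monic_neq0 gmon.
    rewrite -(prednK (_ : 0 < size g)%N) ?size_poly_gt0 // ltnS gE sh.
    by rewrite leq_mul2r -!subn1 leq_sub2r ?orbT.
(* Irreducibility follows from f(X^p - X) being a minimal polynomial, not conversely. *)
split; last exact: minpoly_irreducible hmin.
exact: is_minpoly_uniq (minpolyP (E_alg (c n))) hmin.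
Qed.
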